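(* Let $\mathfrak{g}\subset\mathbb{R}^{n\times n}$ be a matrix Lie algebra with Frobenius-orthogonal projector $P_{\mathfrak g}$, let $J$ be the policy objective, and let $\theta_{t+1}=\theta_t+\eta_tP_{\mathfrak g}(g_t)$, $\theta_0\in\mathfrak{g}$, where $g_t=\widehat{\nabla}J(\theta_t)$ is a stochastic gradient. Suppose assumptions (A1)–(A6) of the context hold and $\eta_t\le1/L$ for all $t$. Then: (i) The sequence $\{J(\theta_t)\}$ converges almost surely. (ii) $\sum_{t=0}^\infty\eta_t\,\mathbb{E}\big[\|P_{\mathfrak g}(\nabla J(\theta_t))\|_F^2\big]<\infty$; in particular $\liminf_{t\to\infty}\mathbb{E}[\|P_{\mathfrak g}(\nabla J(\theta_t))\|_F^2]=0$. (iii) If $\eta_t=\eta/\sqrt{T}$ for all $t<T$ (constant step size for horizon $T$) with $\eta\le1/L$, then $$\mathbb{E}\Big[\frac1T\sum_{t=0}^{T-1}\|P_{\mathfrak g}(\nabla J(\theta_t))\|_F^2\Big]\le\frac{2(J^*-J(\theta_0))}{\eta\sqrt{T}}+\frac{L\eta\sigma_g^2}{\sqrt{T}}=\mathcal{O}\Big(\frac1{\sqrt{T}}\Big).$$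
   Context: $\langle A,B\rangle_F=\mathrm{tr}(A^\top B)$; $P_{\mathfrak g}(M)=\arg\min_{X\in\mathfrak g}\|M-X\|_F^2$. $J(\theta)=\mathbb{E}_{\pi_\theta}[\sum_{t\ge0}\gamma^tr_t]$ is the expected discounted return (to be maximized) of a policy $\pi_\theta$ parameterized by $\theta\in\mathfrak{g}$. $\mathcal{F}_t$ is the filtration containing all randomness up to iteration $t$ (so $\theta_t$ is $\mathcal{F}_t$-measurable), and the unbiasedness and variance assumptions are understood conditionally on $\mathcal{F}_t$ at $\theta=\theta_t$. Assumptions: (A1) Smoothness: $\|\nabla J(\theta)-\nabla J(\theta')\|_F\le L\|\theta-\theta'\|_F$. (A2) Bounded optimum: $J^*=\sup_\theta J(\theta)<\infty$. (A3) Bounded iterates: $\sup_t\|\theta_t\|_F\le B_\theta$. (A4) Unbiased gradient: $\mathbb{E}[\widehat{\nabla}J(\theta)]=\nabla J(\theta)$. (A5) Bounded variance: $\mathbb{E}[\|\widehat{\nabla}J-\nabla J\|_F^2]\le\sigma_g^2$. (A6) Step sizes: $\sum_t\eta_t=\infty$, $\sum_t\eta_t^2<\infty$; for the $\mathcal{O}(1/\sqrt T)$ rate (part (iii)), instead $\eta_t=\eta/\sqrt{T}$ with $\eta\le1/L$. *)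

(* Defs.v *)
From HB Require Import structures.
From mathcomp Require Import all_boot all_order all_algebra.
From mathcomp Require Import all_classical all_reals all_analysis.
Set Implicit Arguments.
Unset Strict Implicit.
Unset Printing Implicit Defensive.
Import Order.TTheory GRing.Theory Num.Theory.
Import numFieldNormedType.Exports.
Local Open Scope classical_set_scope.
Local Open Scope ring_scope.

Definition frob_inner {R : realType} {n : nat} (A B : 'M[R]_n) : R :=
  \tr (A^T *m B).

Definition frob_norm {R : realType} {n : nat} (A : 'M[R]_n) : R :=
  Num.sqrt (frob_inner A A).

Definition is_matrix_lie_algebra {R : realType} {n : nat}
    (g : {vspace 'M[R]_n}) : Prop :=
  forall A B : 'M[R]_n, A \in g -> B \in g -> A *m B - B *m A \in g.

Definition is_frob_argmin {R : realType} {n : nat} (g : {vspace 'M[R]_n})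
    (M X : 'M[R]_n) : Prop :=
  X \in g /\ forall Y : 'M[R]_n, Y \in g ->
    frob_norm (M - X) ^+ 2 <= frob_norm (M - Y) ^+ 2.

(* [xget] picks an element of the set of minimizers; that set is a singleton
   since [g] is a subspace of a Euclidean space, so the default 0 is not used *)
Definition frob_proj {R : realType} {n : nat} (g : {vspace 'M[R]_n})
    (M : 'M[R]_n) : 'M[R]_n :=
  xget 0 [set X | is_frob_argmin g M X].

(* matrix of partial derivatives; where [J] is differentiable it represents
   the differential of [J] for the Frobenius inner product *)
Definition mx_grad {R : realType} {n : nat} (J : 'M[R]_n -> R)
    (theta : 'M[R]_n) : 'M[R]_n :=
  \matrix_(i, j) 'D_(delta_mx i j) J theta.

Section policy_objective.
Context {R : realType} {n : nat} {d : measure_display} {X : measurableType d}.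
(* [law theta] is the law on the trajectory space [X] under the policy of
   parameter [theta]; [r t] is the reward received at time [t] *)
Variables (law : 'M[R]_n -> probability X R) (gamma : R)
  (r : nat -> {mfun X >-> R}).

Definition discounted_return (x : X) : R :=
  limn (series (fun t => gamma ^+ t * r t x)).

Definition has_expected_return (theta : 'M[R]_n) : Prop :=
  {ae law theta, forall x, cvgn (series (fun t => gamma ^+ t * r t x))} /\
  (law theta).-integrable setT (EFin \o discounted_return).

Definition policy_objective (theta : 'M[R]_n) : R :=
  fine 'E_(law theta)[discounted_return].

End policy_objective.

Section conditioning.
Context {R : realType} {d : measure_display} {Omega : measurableType d}.

Definition is_filtration (F : nat -> set (set Omega)) : Prop :=
  [/\ forall t, sigma_algebra setT (F t),
      forall t, F t `<=` measurable
    & forall s t, (s <= t)%N -> F s `<=` F t].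

Definition measurable_wrt (G : set (set Omega)) (X : Omega -> R) : Prop :=
  forall B : set R, measurable B -> G (X @^-1` B).

(* [Y] is a version of the conditional expectation of [X] given [G] *)
Definition is_cond_exp (P : probability Omega R) (G : set (set Omega))
    (X Y : Omega -> R) : Prop :=
  [/\ P.-integrable setT (EFin \o X),
      measurable_wrt G Y,
      P.-integrable setT (EFin \o Y)
    & forall A, G A ->
        (\int[P]_(w in A) (Y w)%:E = \int[P]_(w in A) (X w)%:E)%E].

End conditioning.

(* Main.v *)
(* The standard way to (i) is the Robbins-Siegmund supermartingale theorem; here
   it is replaced by the convergence of one square integrable martingale.

   Write G_t for the projected gradient, h_t for the projected stochastic
   gradient and e_t for the (unprojected) gradient noise. Since the projection is
   self-adjoint, <grad J, h_t> = |G_t|^2 + <G_t, e_t> and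
   |h_t|^2 <= |G_t|^2 + 2 <G_t, e_t> + |e_t|^2, so L-smoothness on the subspace
   gives, pathwise and on both sides,
     J(theta_{t+1}) - J(theta_t)
       = eta_t |G_t|^2 + eta_t <G_t, e_t> + O(eta_t^2 |h_t|^2).
   G_t is bounded because the iterates are, hence <G_t, e_t> is conditionally
   centered. Taking expectations and telescoping yields the bound behind (ii) and
   (iii). For (i), the three series converge almost surely: the first and the
   third because their expectations are summable, the second because it is a
   martingale bounded in L^2. In this way J(theta_t) never has to be shown
   measurable. *)
Require Import Defs.
From HB Require Import structures.
From mathcomp Require Import all_boot all_order all_algebra.
From mathcomp Require Import all_classical all_reals all_analysis.
From mathcomp Require Import measurable_realfun ring lra.
Set Implicit Arguments.
Unset Strict Implicit.
Unset Printing Implicit Defensive.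
Import Order.TTheory GRing.Theory Num.Theory.
Import numFieldNormedType.Exports.
Local Open Scope classical_set_scope.
Local Open Scope ring_scope.

(** * The Frobenius inner product and projection *)

Section frobenius.
Context {R : realType} {n : nat}.
Implicit Types A B C M : 'M[R]_n.

Lemma frob_innerE A B : frob_inner A B = \sum_i \sum_j A i j * B i j.
Proof.
rewrite /frob_inner /mxtrace exchange_big; apply: eq_bigr => j _.
by rewrite mxE; apply: eq_bigr => i _; rewrite mxE.
Qed.

Lemma frob_innerC A B : frob_inner A B = frob_inner B A.
Proof.
rewrite !frob_innerE; apply: eq_bigr => i _; apply: eq_bigr => j _.
exact: mulrC.
Qed.

Lemma frob_innerDr A B C : frob_inner A (B + C) = frob_inner A B + frob_inner A C.
Proof. by rewrite /frob_inner mulmxDr linearD. Qed.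

Lemma frob_innerZr A k B : frob_inner A (k *: B) = k * frob_inner A B.
Proof. by rewrite /frob_inner -scalemxAr linearZ. Qed.

Lemma frob_innerNr A B : frob_inner A (- B) = - frob_inner A B.
Proof. by rewrite -scaleN1r frob_innerZr mulN1r. Qed.

Lemma frob_innerDl A B C : frob_inner (B + C) A = frob_inner B A + frob_inner C A.
Proof. by rewrite !(frob_innerC _ A) frob_innerDr. Qed.

Lemma frob_innerZl A k B : frob_inner (k *: B) A = k * frob_inner B A.
Proof. by rewrite !(frob_innerC _ A) frob_innerZr. Qed.

Lemma frob_innerNl A B : frob_inner (- B) A = - frob_inner B A.
Proof. by rewrite !(frob_innerC _ A) frob_innerNr. Qed.

Lemma frob_inner0r A : frob_inner A 0 = 0.
Proof. by rewrite -(scale0r 0) frob_innerZr mul0r. Qed.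

Definition frob_inner_bilinear :=
  (frob_innerDr, frob_innerDl, frob_innerNr, frob_innerNl, frob_innerZr,
   frob_innerZl).

Lemma frob_inner_sumr A (I : Type) (s : seq I) (P : pred I) (B : I -> 'M[R]_n) :
  frob_inner A (\sum_(i <- s | P i) B i) = \sum_(i <- s | P i) frob_inner A (B i).
Proof.
exact: (big_morph (frob_inner A) (frob_innerDr A) (frob_inner0r A)).
Qed.

Lemma frob_inner_ge0 A : 0 <= frob_inner A A.
Proof.
rewrite frob_innerE; apply: sumr_ge0 => i _; apply: sumr_ge0 => j _.
by rewrite -expr2 sqr_ge0.
Qed.

Lemma frob_inner_eq0 A : frob_inner A A = 0 -> A = 0.
Proof.
rewrite frob_innerE => A0; apply/matrixP => i j; rewrite mxE.
have sq_ge0 k l : 0 <= A k l * A k l by rewrite -expr2 sqr_ge0.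
have /psumr_eq0P/(_ A0)/(_ i isT) Ai0 :
    forall k, true -> 0 <= \sum_l A k l * A k l.
  by move=> k _; exact: sumr_ge0.
have /psumr_eq0P/(_ Ai0)/(_ j isT)/eqP : forall l, true -> 0 <= A i l * A i l.
  by [].
by rewrite -expr2 sqrf_eq0 => /eqP.
Qed.

Lemma sqr_frob_norm A : frob_norm A ^+ 2 = frob_inner A A.
Proof. by rewrite sqr_sqrtr// frob_inner_ge0. Qed.

Lemma frob_norm_ge0 A : 0 <= frob_norm A.
Proof. exact: sqrtr_ge0. Qed.

(** Cauchy-Schwarz: the squared norm of [<A,A> B - <A,B> A] equals [<A,A> (<A,A> <B,B> - <A,B>^2)],
    and its first factor is positive unless [A = 0]. *)
Lemma frob_inner_le A B : `|frob_inner A B| <= frob_norm A * frob_norm B.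
Proof.
have [A0|A0] := eqVneq (frob_inner A A) 0.
  by rewrite (frob_inner_eq0 A0) frob_innerC frob_inner0r normr0 mulr_ge0 ?frob_norm_ge0.
rewrite -ler_sqr ?nnegrE ?mulr_ge0 ?frob_norm_ge0//.
rewrite -normrX ger0_norm ?sqr_ge0// exprMn !sqr_frob_norm.
have A_gt0 : 0 < frob_inner A A by rewrite lt0r A0 frob_inner_ge0.
have := frob_inner_ge0 (frob_inner A A *: B - frob_inner A B *: A).
rewrite !frob_inner_bilinear (frob_innerC B A) => h.
rewrite -subr_ge0 -(pmulr_rge0 _ A_gt0); apply: le_trans h _.
by rewrite le_eqVlt; apply/orP; left; apply/eqP; ring.
Qed.

Lemma frob_normD A B : frob_norm (A + B) <= frob_norm A + frob_norm B.
Proof.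
rewrite -ler_sqr ?nnegrE ?addr_ge0 ?frob_norm_ge0//.
rewrite sqrrD !sqr_frob_norm !frob_inner_bilinear (frob_innerC B A).
have := le_trans (ler_norm _) (frob_inner_le A B).
lra.
Qed.

Lemma frob_normZ k A : frob_norm (k *: A) = `|k| * frob_norm A.
Proof.
by rewrite /frob_norm !frob_inner_bilinear mulrA -expr2 sqrtrM ?sqr_ge0// sqrtr_sqr.
Qed.

Lemma frob_normN A : frob_norm (- A) = frob_norm A.
Proof. by rewrite -scaleN1r frob_normZ normrN1 mul1r. Qed.

Lemma normr_entry_le A i j : `|A i j| <= frob_norm A.
Proof.
rewrite -ler_sqr ?nnegrE ?frob_norm_ge0// sqr_frob_norm -normrX.
rewrite ger0_norm ?sqr_ge0// frob_innerE (bigD1 i)//= (bigD1 j)//= -addrA expr2.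
rewrite lerDl addr_ge0//; last apply: sumr_ge0 => k _; apply: sumr_ge0 => l _;
  by rewrite -expr2 sqr_ge0.
Qed.

Lemma double_frob_inner_le A B :
  2 * frob_inner A B <= frob_norm A ^+ 2 + frob_norm B ^+ 2.
Proof.
have := frob_inner_ge0 (A - B).
by rewrite !frob_inner_bilinear (frob_innerC B A) -!sqr_frob_norm; lra.
Qed.

Section projection.
Variable g : {vspace 'M[R]_n}.

(* The coordinates of the projection in a basis of [g] solve a linear system
   whose matrix, the Gram matrix, has trivial kernel. *)
Lemma orthogonal_decomposition M :
  exists2 X, X \in g & forall Y, Y \in g -> frob_inner (M - X) Y = 0.
Proof.
pose b := vbasis g.
pose Gram := \matrix_(i, j) frob_inner b`_i b`_j : 'M[R]_(\dim g).
have Gram_unit : Gram \in unitmx.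
  rewrite -row_free_unit -kermx_eq0; apply/eqP/row_matrixP => k; rewrite row0.
  set v := row k _.
  have vG : v *m Gram = 0 by rewrite /v -row_mul mulmx_ker row0.
  pose S := \sum_i v 0 i *: b`_i.
  have Sb (j : 'I_(\dim g)) : frob_inner S b`_j = 0.
    have := congr1 (fun x : 'rV__ => x 0 j) vG; rewrite !mxE => <-.
    rewrite frob_innerC frob_inner_sumr; apply: eq_bigr => i _.
    by rewrite !mxE frob_innerZr frob_innerC.
  have S0 : S = 0.
    apply: frob_inner_eq0; rewrite {2}/S frob_inner_sumr big1// => i _.
    by rewrite frob_innerZr Sb mulr0.
  have /freeP/(_ _ S0) v0 : free b by exact: basis_free (vbasisP g).
  by apply/rowP => i; rewrite v0 mxE.
pose c := (\row_j frob_inner M b`_j) *m invmx Gram.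
exists (\sum_i c 0 i *: b`_i).
  apply: memv_suml => i _; apply: memvZ; apply: vbasis_mem.
  by apply: mem_nth; rewrite size_tuple.
have orth (j : 'I_(\dim g)) : frob_inner (M - \sum_i c 0 i *: b`_i) b`_j = 0.
  have : (c *m Gram) 0 j = frob_inner M b`_j.
    by rewrite /c mulmxKV// mxE.
  rewrite !frob_inner_bilinear => <-; rewrite mxE (frob_innerC _ b`_j) frob_inner_sumr.
  apply/eqP; rewrite subr_eq0; apply/eqP; apply: eq_bigr => i _.
  by rewrite [Gram i j]mxE frob_innerZr frob_innerC.
move=> Y /coord_vbasis ->; rewrite frob_inner_sumr big1// => i _.
by rewrite frob_innerZr orth mulr0.
Qed.

(** By Pythagoras, [|M - Y|^2 = |M - X|^2 + |X - Y|^2] for every [Y] in [g]. Hence [X] is a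
    minimizer and any other minimizer is at distance 0 from it, so [xget] can only pick [X]. *)
Lemma orthogonal_frob_proj M X : X \in g ->
  (forall Y, Y \in g -> frob_inner (M - X) Y = 0) -> frob_proj g M = X.
Proof.
move=> Xg orth; apply: xget_unique.
  split=> // Y Yg; rewrite !sqr_frob_norm.
  have := orth _ (memvB Xg Yg); have := frob_inner_ge0 (X - Y).
  by rewrite !frob_inner_bilinear (frob_innerC X M) (frob_innerC Y M) (frob_innerC Y X); lra.
move=> Y [Yg /(_ X Xg)]; rewrite !sqr_frob_norm => YX.
apply/eqP; rewrite -subr_eq0; apply/eqP/frob_inner_eq0/eqP.
rewrite eq_le frob_inner_ge0 andbT.
have := orth _ (memvB Xg Yg); move: YX.
by rewrite !frob_inner_bilinear (frob_innerC X M) (frob_innerC Y M) (frob_innerC Y X); lra.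
Qed.

Lemma frob_proj_mem M : frob_proj g M \in g.
Proof.
by have [X Xg orth] := orthogonal_decomposition M; rewrite (orthogonal_frob_proj Xg).
Qed.

Lemma frob_proj_orthogonal M Y : Y \in g -> frob_inner (M - frob_proj g M) Y = 0.
Proof.
have [X Xg orth] := orthogonal_decomposition M.
by rewrite (orthogonal_frob_proj Xg orth); exact: orth.
Qed.

Lemma frob_inner_proj M Y : Y \in g -> frob_inner Y (frob_proj g M) = frob_inner Y M.
Proof.
move=> /(frob_proj_orthogonal M); rewrite !frob_inner_bilinear !(frob_innerC _ Y).
lra.
Qed.

(** Orthogonality of the residual to [g] characterizes the projection and is stable under linear
    combinations. *)
Lemma frob_proj_is_linear : linear (frob_proj g).
Proof.
move=> k A B; apply: orthogonal_frob_proj.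
  by rewrite memvD ?memvZ ?frob_proj_mem.
move=> Y Yg; have := frob_proj_orthogonal A Yg; have := frob_proj_orthogonal B Yg.
rewrite !frob_inner_bilinear => hB hA.
have -> : frob_inner A Y = frob_inner (frob_proj g A) Y by lra.
lra.
Qed.

HB.instance Definition _ :=
  GRing.isLinear.Build R 'M[R]_n 'M[R]_n *:%R (frob_proj g) frob_proj_is_linear.

Lemma frob_norm_proj_le M : frob_norm (frob_proj g M) <= frob_norm M.
Proof.
rewrite -ler_sqr ?nnegrE ?frob_norm_ge0// !sqr_frob_norm.
have := frob_inner_ge0 (M - frob_proj g M).
have := frob_inner_proj M (frob_proj_mem M).
by rewrite !frob_inner_bilinear (frob_innerC M (frob_proj g M)); lra.
Qed.

End projection.

End frobenius.

(** * Quadratic bounds from a Lipschitz gradient on a subspace *)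

Section smoothness.
Context {R : realType} {n : nat}.
Implicit Types A B x h : 'M[R]_n.
Variable J : 'M[R]_n -> R.

Lemma derive_mx_grad x h : differentiable J x -> 'D_h J x = frob_inner (mx_grad J x) h.
Proof.
move=> Jx; rewrite deriveE// {1}(matrix_sum_delta h) linear_sum frob_innerE.
apply: eq_bigr => i _; rewrite linear_sum; apply: eq_bigr => j _.
by rewrite linearZ/= mxE deriveE// mulrC.
Qed.

(** The difference quotient of [u |-> J (x + u h)] at [s] is, term by term, that of [J] at [x + s h]
    in the direction [h]. *)
Lemma is_derive_line x h (s : R) : differentiable J (x + s *: h) ->
  is_derive s 1 (fun u : R => J (x + u *: h)) (frob_inner (mx_grad J (x + s *: h)) h).
Proof.
move=> Js; rewrite -derive_mx_grad//.
pose F (u : R) := J (x + u *: h).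
have quotient_eq : (fun u : R => u^-1 *: ((F \o shift s) (u *: 1) - F s)) =
    (fun u : R => u^-1 *: ((J \o shift (x + s *: h)) (u *: h) - J (x + s *: h))).
  apply/funext => u; rewrite /F /= scaler1 scalerDl.
  by rewrite addrCA.
have : derivable J (x + s *: h) h by exact: diff_derivable.
rewrite /derivable -quotient_eq => dF.
by apply: DeriveDef; rewrite // /derive -quotient_eq.
Qed.

Variables (g : {vspace 'M[R]_n}) (L : R).
Hypothesis J_diff : forall x, x \in g -> differentiable J x.
Hypothesis J_smooth : forall x y, x \in g -> y \in g ->
  frob_norm (mx_grad J x - mx_grad J y) <= L * frob_norm (x - y).

(** The sign [c] treats the upper and the lower bound at once. The claim is [f 1 <= f 0] for the
    function [f] below, whose derivative is nonpositive on []0, 1[]: the Lipschitz bound between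
    [x + s h] and [x] contributes at most [L s |h|^2], which the quadratic term of [f] cancels. The
    segment stays in [g], where the Lipschitz bound is available. *)
Lemma smooth_le x h (c : R) : x \in g -> h \in g -> c = 1 \/ c = -1 ->
  c * (J (x + h) - J x - frob_inner (mx_grad J x) h)
    <= L / 2 * frob_norm h ^+ 2.
Proof.
move=> xg hg c1.
pose l (s : R) : 'M[R]_n := x + s *: h.
have lg s : l s \in g by apply: memvD => //; exact: memvZ.
pose f (s : R) : R := c * (J (l s) - s * frob_inner (mx_grad J x) h)
                  - L / 2 * frob_norm h ^+ 2 * s ^+ 2.
have fd (s : R) : is_derive s (1 : R) f (c * (frob_inner (mx_grad J (l s)) h
     - frob_inner (mx_grad J x) h) - L * frob_norm h ^+ 2 * s).
  have ld := is_derive_line (J_diff (lg s)).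
  have -> : f = c *: ((J \o l) - (frob_inner (mx_grad J x) h *: id))
                - (L / 2 * frob_norm h ^+ 2) *: (id ^+ 2).
    apply/funext => u; rewrite /f !fctE /=.
    by rewrite /GRing.scale/=; ring.
  apply: is_derive_eq; rewrite /GRing.scale/=.
  by field.
have f_le0 (s : R) : s \in `]0, 1[%R -> derive1 f s <= 0.
  rewrite in_itv/= => /andP[s0 _]; rewrite derive1E derive_val.
  rewrite subr_le0.
  apply: (@le_trans _ _
    (frob_norm (mx_grad J (l s) - mx_grad J x) * frob_norm h)).
    apply: le_trans (frob_inner_le _ _); rewrite !frob_inner_bilinear.
    by case: c1 => ->; rewrite ?mul1r ?mulN1r ?ler_norm// -normrN ler_norm.
  have -> : L * frob_norm h ^+ 2 * s = L * (s * frob_norm h) * frob_norm h by ring.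
  rewrite ler_wpM2r ?frob_norm_ge0//.
  apply: le_trans (J_smooth (lg s) xg) _.
  by rewrite /l addrAC subrr add0r frob_normZ gtr0_norm.
have fc : {within `[0, 1], continuous f}.
  apply: derivable_within_continuous => s _.
  by have [] := fd s.
have := ler0_derive1_le_cc (fun s _ => @ex_derive _ _ _ _ _ _ _ (fd s)) f_le0 fc.
move=> /(_ 1 0); rewrite !in_itv/= !lexx !ler01 => /(_ isT isT isT).
rewrite /f /l scale1r scale0r addr0 expr1n expr0n /= mul1r mul0r mulr1 mulr0 !subr0.
by rewrite mulrBr [c * (_ - _ - _)]mulrBr mulrBr; lra.
Qed.

Lemma smooth_dist_le x h : x \in g -> h \in g ->
  `|J (x + h) - J x - frob_inner (mx_grad J x) h| <= L / 2 * frob_norm h ^+ 2.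
Proof.
move=> xg hg; rewrite ler_norml.
have := smooth_le xg hg (or_introl erefl); have := smooth_le xg hg (or_intror erefl).
by rewrite mul1r mulN1r => ? ?; apply/andP; split; lra.
Qed.

End smoothness.
(** * Integration against sub-sigma-algebras *)

Section conditioning_lemmas.
Context {R : realType} {d : measure_display} {Omega : measurableType d}.
Variable P : probability Omega R.
Implicit Types (X Y D : Omega -> R) (G : set (set Omega)).

Notation Pintegrable X := (P.-integrable setT (EFin \o X)).

Lemma integrable_measurable_fun X : Pintegrable X -> measurable_fun setT X.
Proof. by move=> /(measurable_int P)/measurable_EFinP. Qed.

(** Through this equivalence the closure properties of ordinary measurable functions carry over to a
    sub-sigma-algebra. *)
Lemma measurable_wrtP G X : sigma_algebra setT G ->
  measurable_wrt G X <-> measurable_fun [set: g_sigma_algebraType G] X.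
Proof.
move=> sG; split=> [mX _ B mB|mX B mB].
  by rewrite setTI; apply: sub_sigma_algebra; exact: mX.
by have := mX measurableT B mB; rewrite setTI measurable_g_measurableTypeE.
Qed.

Lemma measurable_wrtS G H X : G `<=` H -> measurable_wrt G X -> measurable_wrt H X.
Proof. by move=> GH mX B /mX /GH. Qed.

Lemma measurable_wrt_measurable G X : G `<=` measurable -> measurable_wrt G X ->
  measurable_fun setT X.
Proof. by move=> Gm mX _ B /mX /Gm; rewrite setTI. Qed.

Section sub_sigma_algebra.
Import HBSimple HBNNSimple.
Variable G : set (set Omega).
Hypotheses (sG : sigma_algebra setT G) (Gm : G `<=` measurable).

Lemma measurable_wrt_cst (c : R) : measurable_wrt G (fun=> c).
Proof. by apply/(measurable_wrtP _ sG); exact: measurable_cst. Qed.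

Lemma measurable_wrtD X Y : measurable_wrt G X -> measurable_wrt G Y ->
  measurable_wrt G (fun w => X w + Y w).
Proof.
move=> /(measurable_wrtP _ sG) mX /(measurable_wrtP _ sG) mY.
by apply/(measurable_wrtP _ sG); exact: measurable_funD.
Qed.

Lemma measurable_wrtM X Y : measurable_wrt G X -> measurable_wrt G Y ->
  measurable_wrt G (fun w => X w * Y w).
Proof.
move=> /(measurable_wrtP _ sG) mX /(measurable_wrtP _ sG) mY.
by apply/(measurable_wrtP _ sG); exact: measurable_funM.
Qed.

Lemma measurable_wrtB X Y : measurable_wrt G X -> measurable_wrt G Y ->
  measurable_wrt G (fun w => X w - Y w).
Proof.
move=> /(measurable_wrtP _ sG) mX /(measurable_wrtP _ sG) mY.
by apply/(measurable_wrtP _ sG); exact: measurable_funB.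
Qed.

Lemma measurable_wrt_sum (I : Type) (s : seq I) (X : I -> Omega -> R) :
  (forall i, measurable_wrt G (X i)) ->
  measurable_wrt G (fun w => \sum_(i <- s) X i w).
Proof.
move=> mX; apply/(measurable_wrtP _ sG); apply: measurable_sum => i.
exact/(measurable_wrtP _ sG).
Qed.

Lemma measurable_wrt_indic A : G A -> measurable_wrt G (\1_A : Omega -> R).
Proof.
move=> GA; apply/(measurable_wrtP _ sG).
by apply: measurable_indic; exact: sub_sigma_algebra.
Qed.

Lemma measurable_wrt_le X (c : R) : measurable_wrt G X -> G [set w | X w <= c].
Proof.
move=> mX; have := mX `]-oo, c]%classic (measurable_itv _).
by congr G; apply/seteqP; split=> w /=; rewrite in_itv.
Qed.

(** The simple functions approximating [Y] are built over the sigma-algebra [G] itself, so their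
    level sets belong to [G] and their products with [D] integrate to 0. Dominated convergence, with
    [|Y D|] as dominating function, passes to the limit. *)
Lemma integral_mul_ge0_eq0 Y D : measurable_wrt G Y -> (forall w, 0 <= Y w) ->
  Pintegrable D -> Pintegrable (fun w => Y w * D w) ->
  (forall A, G A -> (\int[P]_(w in A) (D w)%:E = 0)%E) ->
  (\int[P]_w (Y w * D w)%:E = 0)%E.
Proof.
move=> mY Y_ge0 iD iYD D0.
have mY' : measurable_fun [set: g_sigma_algebraType G] (EFin \o Y).
  by apply/measurable_EFinP/(measurable_wrtP _ sG).
have Y_ge0E : forall w : g_sigma_algebraType G, [set: g_sigma_algebraType G] w ->
    (0 <= (EFin \o Y) w)%E by move=> w _; rewrite lee_fin.
pose b := nnsfun_approx measurableT mY'.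
pose a m (w : Omega) : R := b m w.
have am m : measurable_wrt G (a m).
  by apply/(measurable_wrtP _ sG); exact: measurable_funPT.
have a_cvg w : a ^~ w @ \oo --> Y w.
  by have := cvg_nnsfun_approx measurableT mY' Y_ge0E (I : setT w); move/fine_cvg.
have a_le m w : a m w <= Y w.
  rewrite /a /b nnsfun_approxE -lee_fin.
  exact: (@le_approx _ _ _ _ _ m w Y_ge0E).
have int_a m : (\int[P]_w (a m w * D w)%:E = 0)%E.
  pose A x := a m @^-1` [set x].
  have GA x : G (A x) by exact: am.
  have mA x : measurable (A x) by exact: Gm.
  have indicD x : (fun w => (\1_(A x) w * D w)%:E) = (EFin \o D) \_ (A x).
    apply/funext => w; rewrite /patch indicE /=.
    by case: ifP => _; rewrite ?mul1r ?mul0r.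
  have i_indicD x : Pintegrable (fun w => \1_(A x) w * D w).
    rewrite [EFin \o _]indicD -integrable_mkcond//.
    by apply: integrableS iD => //; exact: Gm.
  under eq_integral => w _ do rewrite /a fimfunEord mulr_suml -sumEFin.
  rewrite integral_sum// => [|i].
    rewrite big1// => i _.
    under eq_integral => w _ do rewrite -mulrA EFinM.
    rewrite integralZl//; last exact: i_indicD.
    by rewrite indicD -integral_mkcond D0// mule0.
  under eq_fun do rewrite -mulrA EFinM.
  by apply: integrableZl => //; exact: i_indicD.
have mD := integrable_measurable_fun iD.
have am' k : measurable_fun setT (a k).
  exact: measurable_wrt_measurable (am k).
have mY'' : measurable_fun setT Y by exact: measurable_wrt_measurable mY.
have mf m : measurable_fun setT (fun w => (a m w * D w)%:E).
  by apply/measurable_EFinP; exact: measurable_funM.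
have f_cvg : {ae P, forall w, setT w ->
    (a m w * D w)%:E @[m --> \oo] --> (Y w * D w)%:E}.
  apply: aeW => w _; apply: cvg_EFin; first exact: nearW.
  by apply: cvgM; [exact: a_cvg|exact: cvg_cst].
have f_le : {ae P, forall w m, setT w ->
    (`|(a m w * D w)%:E| <= (abse \o (EFin \o (fun w => (Y w * D w)%R))) w)%E}.
  apply: aeW => w m _; rewrite lee_fin !normrM ler_wpM2r//.
  by rewrite !ger0_norm.
have [_ _] := dominated_convergence measurableT mf
  (measurable_int P iYD) f_cvg (integrable_abse iYD) f_le.
under eq_fun do rewrite int_a.
by move=> /cvg_lim <-//; exact: lim_cst.
Qed.

(** The positive and negative parts of [Y] are treated separately; both products with [D] are
    dominated by [|Y D|]. *)
Lemma integral_mul_eq0 Y D : measurable_wrt G Y ->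
  Pintegrable D -> Pintegrable (fun w => Y w * D w) ->
  (forall A, G A -> (\int[P]_(w in A) (D w)%:E = 0)%E) ->
  (\int[P]_w (Y w * D w)%:E = 0)%E.
Proof.
move=> mY iD iYD D0.
have mY_ := measurable_wrt_measurable Gm mY.
have mD := integrable_measurable_fun iD.
have mYp : measurable_wrt G (Y^\+)%R.
  by apply/(measurable_wrtP _ sG)/measurable_funrpos/(measurable_wrtP _ sG).
have mYn : measurable_wrt G (Y^\-)%R.
  by apply/(measurable_wrtP _ sG)/measurable_funrneg/(measurable_wrtP _ sG).
have iYpD : Pintegrable (fun w => (Y^\+)%R w * D w).
  apply: le_integrable iYD => //.
    apply/measurable_EFinP/measurable_funM => //.
    exact: measurable_wrt_measurable mYp.
  move=> w _; rewrite lee_fin !normrM ler_wpM2r// /funrpos.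
  by rewrite /Num.max; case: ifP => // _; rewrite normr0.
have iYnD : Pintegrable (fun w => (Y^\-)%R w * D w).
  apply: le_integrable iYD => //.
    apply/measurable_EFinP/measurable_funM => //.
    exact: measurable_wrt_measurable mYn.
  move=> w _; rewrite lee_fin !normrM ler_wpM2r// /funrneg.
  by rewrite /Num.max; case: ifP => // _; rewrite ?normr0// normrN.
rewrite (_ : (fun w => _) =
  (fun w => ((Y^\+)%R w * D w)%:E - ((Y^\-)%R w * D w)%:E)%E).
  rewrite integralB_EFin// (integral_mul_ge0_eq0 mYp (funrpos_ge0 Y))//.
  by rewrite (integral_mul_ge0_eq0 mYn (funrneg_ge0 Y))// subee.
apply/funext => w; rewrite -EFinB -mulrBl; congr (_ * _)%:E.
by have := congr1 (fun f => f w) (funrposBneg Y).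
Qed.

End sub_sigma_algebra.

(** Domination is asked only almost everywhere because the iterates are bounded only almost
    surely. *)
Lemma ae_le_integrable X Y : measurable_fun setT X -> Pintegrable Y ->
  {ae P, forall w, `|X w| <= Y w} -> Pintegrable X.
Proof.
move=> mX iY XY; have mY := integrable_measurable_fun iY.
apply/integrableP; split; first exact/measurable_EFinP.
have /integrableP[_] := iY; apply: le_lt_trans.
apply: ae_ge0_le_integral => //.
- by apply/measurableT_comp => //; exact/measurable_EFinP.
- by apply/measurableT_comp => //; exact/measurable_EFinP.
- apply: filterS XY => w + _; rewrite !lee_fin => /le_trans; apply.
  exact: ler_norm.
Qed.

Lemma integrableM_ae_bounded X Y (C : R) : measurable_fun setT X -> Pintegrable Y ->
  {ae P, forall w, `|X w| <= C} -> Pintegrable (fun w => X w * Y w).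
Proof.
move=> mX iY XC; have mY := integrable_measurable_fun iY.
apply: (@ae_le_integrable _ (fun w => C * `|Y w|)).
- exact: measurable_funM.
- exact: (integrableZl measurableT C (integrable_norm iY)).
- by apply: filterS XC => w XC; rewrite normrM ler_wpM2r.
Qed.

Lemma integrable_cst_probability (c : R) : Pintegrable (fun=> c).
Proof. exact: finite_measure_integrable_cst. Qed.

End conditioning_lemmas.
(** * Convergence of square integrable martingales *)

Section square_integrable_martingale.
Context {R : realType} {d : measure_display} {Omega : measurableType d}.
Variables (P : probability Omega R) (F : nat -> set (set Omega)).
Hypothesis F_filtration : is_filtration F.
Variables (xi : nat -> Omega -> R) (v : nat -> R).
Hypotheses (xi_meas : forall t, measurable_wrt (F t.+1) (xi t))
  (xi_int : forall t, P.-integrable setT (EFin \o xi t))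
  (xi_mart : forall t A, F t A -> (\int[P]_(w in A) (xi t w)%:E = 0)%E)
  (xi_sqr : forall t, (\int[P]_w (xi t w ^+ 2)%:E <= (v t)%:E)%E)
  (v_ge0 : forall t, 0 <= v t).

Let F_sigma t : sigma_algebra setT (F t).
Proof. by case: F_filtration. Qed.

Let F_measurable t : F t `<=` measurable.
Proof. by case: F_filtration. Qed.

(* Freezing the partial sums once they leave [-lam, lam] makes the predictable
   factor of each increment bounded, so that no maximal inequality for
   submartingales is needed. *)
Fixpoint stopped_sum (m : nat) (lam : R) (k : nat) (w : Omega) : R :=
  if k is k'.+1 then
    stopped_sum m lam k' w
    + \1_[set w | `|stopped_sum m lam k' w| <= lam] w * xi (m + k') w
  else 0.

Section stopped.
Variables (m : nat) (lam : R).
Hypothesis lam_gt0 : 0 < lam.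
Notation Z := (stopped_sum m lam).
Let inside k := [set w | `|Z k w| <= lam].

Lemma stopped_sum_inside k w : inside k w -> Z k.+1 w = Z k w + xi (m + k) w.
Proof. by move=> Zk /=; rewrite indicE mem_set// mul1r. Qed.

Lemma stopped_sum_outside k w : ~ inside k w -> Z k.+1 w = Z k w.
Proof. by move=> Zk /=; rewrite indicE memNset// mul0r addr0. Qed.

(** Once outside the band the sum is frozen, hence outside forever; this is the contrapositive. *)
Lemma inside_anti j k : (j <= k)%N -> inside k `<=` inside j.
Proof.
move=> /subnK <-; elim: (k - j)%N => // i IH w; rewrite addSn => Zi.
apply: IH; apply: contrapT => nZ; apply: (nZ).
move: Zi; rewrite /inside /= -/(Z _ w) -[X in `|X|]/(Z (i + j).+1 w).
by rewrite stopped_sum_outside.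
Qed.

Lemma stopped_sum_series k w : inside k w -> Z k w = \sum_(i < k) xi (m + i) w.
Proof.
elim: k => [|k IH] Zk; first by rewrite big_ord0.
have Zk' := inside_anti (leqnSn k) Zk.
by rewrite stopped_sum_inside// IH// big_ord_recr.
Qed.

(** [Z k] involves [xi m], ..., [xi (m + k - 1)], and [xi t] is known at time [t + 1]. So [Z k] is
    known at time [m + k], just before the increment [xi (m + k)] that it multiplies in the next
    lemmas. *)
Lemma stopped_sum_measurable k : measurable_wrt (F (m + k)) (Z k) /\ F (m + k) (inside k).
Proof.
have in_meas j : measurable_wrt (F (m + j)) (Z j) -> F (m + j) (inside j).
  move=> mZ; apply: measurable_wrt_le.
  by apply/(measurable_wrtP _ (F_sigma _))/measurableT_comp => //;
     exact/(measurable_wrtP _ (F_sigma _)).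
suff mZ : measurable_wrt (F (m + k)) (Z k) by split=> //; exact: in_meas.
elim: k => [|k IH] /=; first exact: measurable_wrt_cst.
have FS : F (m + k) `<=` F (m + k).+1 by case: F_filtration => _ _; apply.
rewrite addnS; apply: measurable_wrtD => //; first exact: measurable_wrtS IH.
apply: measurable_wrtM => //; apply: measurable_wrt_indic => //.
by apply: FS; exact: in_meas.
Qed.

Lemma xi_sqr_integrable t : P.-integrable setT (EFin \o (fun w => xi t w ^+ 2)).
Proof.
have mxi := integrable_measurable_fun (xi_int t).
apply/integrableP; split; first by apply/measurable_EFinP/measurable_funX.
apply: le_lt_trans (ltry (v t)); apply: le_trans (xi_sqr t).
rewrite le_eqVlt; apply/orP; left; apply/eqP/eq_integral => w _.
by rewrite gee0_abs// lee_fin sqr_ge0.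
Qed.

(** Orthogonality of martingale increments: in the expansion of [Z k.+1 ^+ 2] the cross term is
    [xi (m + k)] times [Y], the sum [Z k] cut off outside the band. [Y] is bounded by [lam] and
    known at time [m + k], so this term integrates to 0. *)
Lemma stopped_sum_sqr k : P.-integrable setT (EFin \o (fun w => Z k w ^+ 2)) /\
  (\int[P]_w (Z k w ^+ 2)%:E <= (\sum_(i < k) v (m + i))%:E)%E.
Proof.
elim: k => [|k [iZ leZ]].
  rewrite /= expr0n/=; split; first exact: integrable_cst_probability.
  by rewrite integral_cst// mul0e big_ord0.
have [mZ Fin] := stopped_sum_measurable k.
pose Y w := \1_(inside k) w * Z k w : R.
have mY : measurable_wrt (F (m + k)) Y.
  by apply: measurable_wrtM => //; exact: measurable_wrt_indic.
have iYxi : P.-integrable setT (EFin \o (fun w => Y w * xi (m + k) w)).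
  apply: (@integrableM_ae_bounded _ _ _ _ _ _ lam) => //.
    exact: measurable_wrt_measurable mY.
  apply: aeW => w; rewrite /Y indicE.
  have [/set_mem|_] := boolP (w \in inside k); first by rewrite mul1r.
  by rewrite mul0r normr0 ltW.
have Yxi0 := integral_mul_eq0 (F_sigma _) (@F_measurable _) mY (xi_int _)
  iYxi (@xi_mart (m + k)).
have ixi := xi_sqr_integrable (m + k).
have i2 : P.-integrable setT (EFin \o (fun w => \1_(inside k) w * xi (m + k) w ^+ 2)).
  apply: (@integrableM_ae_bounded _ _ _ _ _ _ 1) => //.
    by apply: measurable_indic; exact: F_measurable Fin.
  by apply: aeW => w; rewrite indicE; case: (_ \in _); rewrite ?normr1// normr0.
have ZE w : Z k.+1 w ^+ 2 = Z k w ^+ 2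
    + (2 * (Y w * xi (m + k) w) + \1_(inside k) w * xi (m + k) w ^+ 2).
  rewrite /= -/(inside k) /Y indicE; case: (_ \in _) => /=; ring.
have i1 : P.-integrable setT (EFin \o (fun w => 2 * (Y w * xi (m + k) w))).
  exact: (integrableZl measurableT 2 iYxi).
have i10 : (\int[P]_w (2 * (Y w * xi (m + k) w))%:E = 0)%E.
  under eq_integral do rewrite EFinM.
  by rewrite integralZl// Yxi0 mule0.
have i12 := integrableD measurableT i1 i2.
have -> : (fun w => Z k.+1 w ^+ 2) = (fun w => Z k w ^+ 2
    + (2 * (Y w * xi (m + k) w) + \1_(inside k) w * xi (m + k) w ^+ 2)).
  exact/funext.
split; first exact: (integrableD measurableT iZ i12).
under eq_integral => w _ do rewrite ZE.
rewrite integralD_EFin//.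
rewrite integralD_EFin//.
rewrite [X in (_ + (X + _))%E]i10 add0e big_ord_recr/= EFinD leeD//.
apply: le_trans (xi_sqr (m + k)); apply: le_integral => // w _.
rewrite lee_fin indicE; case: (_ \in _); rewrite ?mul1r// mul0r.
exact: sqr_ge0.
Qed.

Lemma stopped_sum_chebyshev k :
  (P (~` inside k) <= (lam ^- 2 * \sum_(i < k) v (m + i))%:E)%E.
Proof.
have [_ Fin] := stopped_sum_measurable k; have [iZ leZ] := stopped_sum_sqr k.
have mC : measurable (~` inside k) by apply: measurableC; exact: F_measurable Fin.
rewrite EFinM lee_pdivlMl ?exprn_gt0//; apply: le_trans leZ.
rewrite -integral_cst//.
have mZ : measurable_fun setT (EFin \o (fun w => Z k w ^+ 2)) := measurable_int P iZ.
apply: (@le_trans _ _ (\int[P]_(w in ~` inside k) (Z k w ^+ 2)%:E)%E).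
  apply: ge0_le_integral => //.
  - by move=> w _; rewrite lee_fin sqr_ge0.
  - exact: measurable_funTS.
  move=> w nin; have /ltW lamZ : lam < `|Z k w| by rewrite ltNge; apply/negP.
  by rewrite lee_fin -[leRHS]ger0_norm ?sqr_ge0// normrX ler_sqr ?nnegrE// ltW.
apply: ge0_subset_integral => // w _; rewrite lee_fin sqr_ge0//.
Qed.

(** This plays the role of a maximal inequality. Thanks to freezing, the events of being outside at
    time [k] increase with [k], so the probability of ever leaving is the limit of the Chebyshev
    bounds. *)
Lemma stopped_sum_maximal :
  measurable (\bigcup_k ~` inside k) /\
  (P (\bigcup_k ~` inside k) <=
    (lam ^- 2)%:E * \sum_(m <= t <oo) (v t)%:E)%E.
Proof.
have mC k : measurable (~` inside k).
  by apply: measurableC; have [_] := stopped_sum_measurable k; exact: F_measurable.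
have mU : measurable (\bigcup_k ~` inside k) by exact: bigcupT_measurable.
split=> //.
have nd : nondecreasing_seq (fun k => ~` inside k).
  by move=> j k jk; apply/subsetPset; apply: subsetC; exact: inside_anti.
have cv := @nondecreasing_cvg_mu _ _ _ P _ mC mU nd.
apply: (cvge_to_le cv); apply: nearW => k.
apply: le_trans (stopped_sum_chebyshev k) _.
rewrite EFinM; apply: lee_wpmul2l; first by rewrite lee_fin invr_ge0 sqr_ge0.
have -> : \sum_(i < k) v (m + i) = \sum_(m <= t < m + k) v t.
  rewrite -[m in RHS]add0n big_addn addKn big_mkord.
  by apply: eq_bigr => i _; rewrite addnC.
rewrite -sumEFin; apply: nneseries_lim_ge => t _ _.
by rewrite lee_fin.
Qed.
End stopped.

(** For a fixed level [lam j], the probability that the sums started at [m] ever escape is at most a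
    constant times a tail of the series of [v], which tends to 0 with [m]. Almost surely, then, each
    of the countably many levels has a starting rank without escape, which is the Cauchy
    criterion. *)
Theorem square_integrable_martingale_cvg :
  (\sum_(0 <= t <oo) (v t)%:E < +oo)%E ->
  {ae P, forall w, cvgn (series (fun t => xi t w))}.
Proof.
move=> v_fin.
pose lam j : R := j.+1%:R^-1.
have lam_gt0 j : 0 < lam j by rewrite invr_gt0.
pose escape m j := \bigcup_k ~` [set w | `|stopped_sum m (lam j) k w| <= lam j].
have escapeP m j := stopped_sum_maximal m (lam_gt0 j).
have null j : P.-negligible (\bigcap_m escape m j).
  exists (\bigcap_m escape m j); split=> //.
    by apply: bigcapT_measurable => m; have [] := escapeP m j.
  apply/eqP; rewrite eq_le measure_ge0 andbT.
  have tail0 := nneseries_tail_cvg v_fin (fun t _ => v_ge0 t).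
  have : ((lam j ^- 2)%:E * \sum_(m <= t <oo) (v t)%:E @[m --> \oo] -->
      (lam j ^- 2)%:E * 0)%E.
    exact: cvgeZl tail0.
  rewrite mule0 => cv0; apply: (cvge_to_ge cv0); apply: nearW => m.
  (* The intersection over all ranks is contained in each [escape m j], so its probability is below
     every term of a sequence tending to 0. *)
  have [mE PE] := escapeP m j; apply: le_trans PE.
  apply: le_measure; rewrite ?inE//; last exact: bigcap_inf.
  by apply: bigcapT_measurable => i; have [] := escapeP i j.
have := negligible_bigcup null; apply: negligibleS => w; apply: contra_notP => nbad.
apply/cauchy_cvgP/cauchy_seriesP => e e0.
have e2 : 0 < e / 2 by rewrite divr_gt0.
have [j _ /(_ j (leqnn j)) /= jlt] := near_infty_natSinv_lt (PosNum e2).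
have [m mj] : exists m, ~ escape m j w.
  by apply/existsNP => allm; apply: nbad; exists j => // m _; exact: allm.
(* A path that never escapes is never frozen, so the bound on the stopped sums is a bound on the
   true partial sums from [m]. *)
have S_le k : (m <= k)%N -> `|\sum_(m <= t < k) xi t w| <= lam j.
  move=> mk; have ins : `|stopped_sum m (lam j) (k - m) w| <= lam j.
    by apply: contrapT => nk; apply: mj; exists (k - m)%N.
  have -> : \sum_(m <= t < k) xi t w = \sum_(i < k - m) xi (m + i) w.
    rewrite -{1}[m]add0n big_addn big_mkord.
    by apply: eq_bigr => i _; rewrite addnC.
  by rewrite -(stopped_sum_series ins).
near=> n => /=.
have m1 : (m <= n.1)%N by near: n; exists ([set k | (m <= k)%N], setT) => /=;
  [split; [exists m|exact: filterT] | move=> x []].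
have m2 : (m <= n.2)%N by near: n; exists (setT, [set k | (m <= k)%N]) => /=;
  [split; [exact: filterT|exists m] | move=> x []].
have [n12|n21] := leqP n.1 n.2; last by rewrite big_geq ?normr0// ltnW.
(* A block is the difference of two sums started at [m], each below [e / 2]. *)
have -> : \sum_(n.1 <= k < n.2) xi k w =
    \sum_(m <= k < n.2) xi k w - \sum_(m <= k < n.1) xi k w.
  by rewrite (big_cat_nat m1 n12)/= addrC addrK.
apply: le_lt_trans (ler_normB _ _) _.
rewrite (splitr e); apply: ltrD; apply: le_lt_trans jlt; exact: S_le.
Unshelve. all: by end_near. Qed.

End square_integrable_martingale.

(** * Series with nonnegative terms *)

Section nonnegative_series.
Context {R : realType}.

Lemma nneseries_lty_cvg (f : nat -> R) : (forall t, 0 <= f t) ->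
  (\sum_(0 <= t <oo) (f t)%:E < +oo)%E -> cvgn (series f).
Proof.
move=> f_ge0 f_lty.
have s_fin : (\sum_(0 <= t <oo) (f t)%:E)%E \is a fin_num.
  by rewrite ge0_fin_numE// nneseries_ge0// => t _ _; rewrite lee_fin.
apply: nondecreasing_is_cvgn; first exact: nondecreasing_series.
exists (fine (\sum_(0 <= t <oo) (f t)%:E)%E) => _ [k _ <-].
rewrite -lee_fin fineK// /series/= -sumEFin.
by apply: nneseries_lim_ge => t _ _; rewrite lee_fin.
Qed.

Lemma partial_sums_le_nneseries (f : nat -> R) (M : R) : (forall t, 0 <= f t) ->
  (forall k, \sum_(0 <= t < k) f t <= M) -> (\sum_(0 <= t <oo) (f t)%:E <= M%:E)%E.
Proof.
move=> f_ge0 f_le; apply: lime_le.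
  by apply: is_cvg_nneseries => t _ _; rewrite lee_fin.
by apply: nearW => k; rewrite sumEFin lee_fin.
Qed.

(** By Tonelli the sum of the integrals is the integral of the sum, which is therefore integrable
    and finite almost everywhere. *)
Lemma ae_cvg_series d (Omega : measurableType d) (P : probability Omega R)
    (f : nat -> Omega -> R) :
  (forall t, measurable_fun setT (f t)) -> (forall t w, 0 <= f t w) ->
  (\sum_(0 <= t <oo) \int[P]_w (f t w)%:E < +oo)%E ->
  {ae P, forall w, cvgn (series (fun t => f t w))}.
Proof.
move=> mf f_ge0 f_lty.
have mF t : measurable_fun setT (fun w => (f t w)%:E) by exact/measurable_EFinP.
have F_ge0 t w : setT w -> (0 <= (f t w)%:E)%E by rewrite lee_fin.
have iF : P.-integrable setT (fun w => \sum_(0 <= t <oo) (f t w)%:E)%E.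
  apply/integrableP; split.
    by apply: ge0_emeasurable_sum => [t w _ _|t _]; [exact: F_ge0|exact: mF].
  have S_ge0 w : (0 <= \sum_(0 <= t <oo) (f t w)%:E)%E.
    by apply: nneseries_ge0 => t _ _; rewrite lee_fin.
  under eq_integral => w _ do rewrite (gee0_abs (S_ge0 w)).
  by rewrite integral_nneseries.
have := integrable_ae measurableT iF; apply: filterS => w /(_ I) fin_w.
apply: nneseries_lty_cvg => //; rewrite -ge0_fin_numE//.
by apply: nneseries_ge0 => t _ _; rewrite lee_fin.
Qed.

(* If [u] stayed above some [m > 0] from rank [k] on, the weighted series would
   dominate [m] times a tail of the divergent series of weights. *)
Lemma limn_einf_eq0 (eta u : nat -> R) :
  (forall t, 0 <= eta t) -> (forall t, 0 <= u t) ->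
  (\sum_(0 <= t <oo) (eta t)%:E = +oo)%E ->
  (\sum_(0 <= t <oo) (eta t * u t)%:E < +oo)%E ->
  limn_einf (fun t => (u t)%:E) = 0%E.
Proof.
move=> eta_ge0 u_ge0 eta_oo etau_lty.
have einf_ge0 k : (0 <= einfs (fun t => (u t)%:E) k)%E.
  by apply: le_ereal_inf_tmp => _ [t _ <-]; rewrite lee_fin.
suff einf0 k : einfs (fun t => (u t)%:E) k = 0%E.
  rewrite limn_einf_lim (_ : einfs _ = cst 0%E); last exact/funext.
  exact: lim_cst.
apply/eqP; rewrite eq_le einf_ge0 andbT leNgt; apply/negP => m_gt0.
have m_le t : (k <= t)%N -> (einfs (fun t => (u t)%:E) k <= (u t)%:E)%E.
  by move=> kt; apply: ereal_inf_lbound; exists t.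
have m_fin : einfs (fun t => (u t)%:E) k \is a fin_num.
  by rewrite ge0_fin_numE//; apply: le_lt_trans (m_le k (leqnn k)) (ltry _).
move: m_gt0 m_le; rewrite -(fineK m_fin); set m := fine _.
rewrite lte_fin => m_gt0 m_le.
have tail_oo : (\sum_(k <= t <oo) (eta t)%:E = +oo)%E.
  move: eta_oo; rewrite (nneseries_split 0 k); last by move=> t _; rewrite lee_fin.
  rewrite add0n sumEFin.
  by case: (\sum_(k <= t <oo) (eta t)%:E)%E.
have : (\sum_(k <= t <oo) (eta t * u t)%:E < +oo)%E.
  apply: le_lt_trans etau_lty.
  rewrite [leRHS](nneseries_split 0 k); last first.
    by move=> t _; rewrite lee_fin mulr_ge0.
  rewrite add0n leeDr// sume_ge0// => t _; rewrite lee_fin mulr_ge0//.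
apply/negP; rewrite -leNgt.
have <- : (m%:E * \sum_(k <= t <oo) (eta t)%:E = +oo)%E.
  by rewrite tail_oo gt0_muley// lte_fin.
rewrite -nneseriesZl; last by move=> t _; rewrite lee_fin.
apply: lee_lim.
- by apply: is_cvg_nneseries => t _ _; rewrite -EFinM lee_fin mulr_ge0// ltW.
- by apply: is_cvg_nneseries => t _ _; rewrite lee_fin mulr_ge0.
- apply: nearW => j; rewrite !sumEFin lee_fin; apply: ler_sum_nat => t /andP[kt _].
  by rewrite mulrC ler_wpM2l// -lee_fin m_le.
Qed.

End nonnegative_series.
(** * Projected stochastic gradient ascent *)

Section projected_stochastic_gradient.
Context {R : realType} {n : nat} {d : measure_display} {Omega : measurableType d}.
Variables (P : probability Omega R) (F : nat -> set (set Omega)).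
Hypothesis F_filtration : is_filtration F.
Variables (g : {vspace 'M[R]_n}) (J : 'M[R]_n -> R) (L : R).
Hypotheses (L_gt0 : 0 < L)
  (J_diff : forall x, x \in g -> differentiable J x)
  (J_smooth : forall x y, x \in g -> y \in g ->
     frob_norm (mx_grad J x - mx_grad J y) <= L * frob_norm (x - y))
  (J_bounded : has_ubound [set J x | x in [set` g]]).
Variables (eta : nat -> R) (theta0 : 'M[R]_n) (theta ghat : nat -> Omega -> 'M[R]_n).
Hypotheses (theta0_g : theta0 \in g) (theta_init : forall w, theta 0%N w = theta0)
  (theta_step : forall t w,
     theta t.+1 w = theta t w + eta t *: frob_proj g (ghat t w))
  (theta_adapted : forall t i j, measurable_wrt (F t) (fun w => theta t w i j)).
Variables (Btheta sigma_g : R).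
Hypotheses (theta_bounded : {ae P, forall w, forall t, frob_norm (theta t w) <= Btheta})
  (ghat_unbiased : forall t i j,
     is_cond_exp P (F t) (fun w => ghat t w i j)
       (fun w => mx_grad J (theta t w) i j))
  (ghat_variance : forall t, exists2 V : Omega -> R,
     is_cond_exp P (F t)
       (fun w => frob_norm (ghat t w - mx_grad J (theta t w)) ^+ 2) V
     & {ae P, forall w, V w <= sigma_g ^+ 2})
  (eta_ge0 : forall t, 0 <= eta t) (eta_le : forall t, eta t <= L^-1).

Notation Pintegrable X := (P.-integrable setT (EFin \o X)).
Notation Jstar := (sup [set J x | x in [set` g]]).

Let grad t w := mx_grad J (theta t w).
Let pgrad t w := frob_proj g (grad t w).
Let noise t w : 'M[R]_n := ghat t w - grad t w.
Let gain t w := frob_norm (pgrad t w) ^+ 2.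
Let cross t w := frob_inner (pgrad t w) (noise t w).
Let noise2 t w := frob_norm (noise t w) ^+ 2.

Let F_sigma t : sigma_algebra setT (F t).
Proof. by case: F_filtration. Qed.

Let F_measurable t : F t `<=` measurable.
Proof. by case: F_filtration. Qed.

Let F_setT t : F t setT.
Proof. by have [F0 FC _] := F_sigma t; rewrite -[setT]setD0; exact: FC. Qed.

Let gain_ge0 t w : 0 <= gain t w. Proof. exact: sqr_ge0. Qed.

Let noise2_ge0 t w : 0 <= noise2 t w. Proof. exact: sqr_ge0. Qed.

(** * Pathwise estimates along the iteration *)

Lemma theta_g t w : theta t w \in g.
Proof.
elim: t => [|t IH]; first by rewrite theta_init.
by rewrite theta_step memvD// memvZ// frob_proj_mem.
Qed.

Lemma pgrad_g t w : pgrad t w \in g. Proof. exact: frob_proj_mem. Qed.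

Lemma inner_pgrad_step t w :
  frob_inner (pgrad t w) (frob_proj g (ghat t w)) = gain t w + cross t w.
Proof.
rewrite frob_inner_proj ?pgrad_g// /cross /noise /gain sqr_frob_norm.
rewrite frob_innerDr frob_innerNr.
by have := frob_inner_proj (grad t w) (pgrad_g t w); rewrite -/(pgrad t w); lra.
Qed.

(** The cross term is kept instead of being absorbed in the squares: it has mean 0, and this is what
    gives the stated constants in the rate. *)
Lemma sqr_norm_step_le t w :
  frob_norm (frob_proj g (ghat t w)) ^+ 2 <= gain t w + 2 * cross t w + noise2 t w.
Proof.
have -> : frob_proj g (ghat t w) = pgrad t w + frob_proj g (noise t w).
  by rewrite -linearD/= /noise addrC subrK.
rewrite sqr_frob_norm !frob_inner_bilinear (frob_innerC _ (pgrad t w)).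
rewrite frob_inner_proj ?pgrad_g// -/(cross t w) -!sqr_frob_norm -/(gain t w).
have : frob_norm (frob_proj g (noise t w)) ^+ 2 <= noise2 t w.
  by rewrite ler_sqr ?nnegrE ?frob_norm_ge0// frob_norm_proj_le.
lra.
Qed.

Lemma increment_dist_le t w :
  `|J (theta t.+1 w) - J (theta t w) - eta t * (gain t w + cross t w)|
    <= L / 2 * eta t ^+ 2 * frob_norm (frob_proj g (ghat t w)) ^+ 2.
Proof.
have hg : frob_proj g (ghat t w) \in g by exact: frob_proj_mem.
have := smooth_dist_le J_diff J_smooth (theta_g t w) (memvZ (eta t) hg).
rewrite -theta_step frob_innerZr frob_innerC -(frob_inner_proj (mx_grad _ _) hg).
rewrite frob_innerC inner_pgrad_step => /le_trans; apply.
by rewrite frob_normZ exprMn -normrX ger0_norm ?sqr_ge0// mulrA.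
Qed.

Lemma step_le t : L * eta t ^+ 2 <= eta t.
Proof. by rewrite expr2 mulrA ler_piMl// -(mulfV (lt0r_neq0 L_gt0)) ler_wpM2l// ltW. Qed.

Lemma increment_ge t w :
  eta t / 2 * gain t w + (eta t - L * eta t ^+ 2) * cross t w
    - L / 2 * eta t ^+ 2 * noise2 t w <= J (theta t.+1 w) - J (theta t w).
Proof.
have := increment_dist_le t w; rewrite ler_norml => /andP[+ _].
have c_ge0 : 0 <= L / 2 * eta t ^+ 2.
  by rewrite mulr_ge0 ?sqr_ge0// divr_ge0// ltW.
have := ler_wpM2l c_ge0 (sqr_norm_step_le t w).
have : L * eta t ^+ 2 * gain t w <= eta t * gain t w by rewrite ler_wpM2r// step_le.
lra.
Qed.

(** The constant compares the gradient at [theta t] with the one at [theta0] by the Lipschitz bound;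
    [Btheta] enters through its absolute value so that the constant is visibly nonnegative. The
    bound makes [gain] and the products of the projected gradient with the noise integrable. *)
Lemma pgrad_bounded : exists2 C : R, 0 <= C &
  {ae P, forall w, forall t, frob_norm (pgrad t w) <= C}.
Proof.
exists (frob_norm (mx_grad J theta0) + L * (`|Btheta| + frob_norm theta0)).
  by rewrite addr_ge0 ?frob_norm_ge0// mulr_ge0 ?addr_ge0 ?frob_norm_ge0// ltW.
apply: filterS theta_bounded => w Bw t; apply: le_trans (frob_norm_proj_le _ _) _.
rewrite /grad -[mx_grad J (theta t w)](subrK (mx_grad J theta0)) addrC.
apply: le_trans (frob_normD _ _) _; rewrite lerD2l.
apply: le_trans (J_smooth (theta_g t w) theta0_g) _.
rewrite ler_pM2l//; apply: le_trans (frob_normD _ _) _; rewrite frob_normN lerD2r.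
exact: le_trans (Bw t) (ler_norm _).
Qed.

Lemma measurable_wrt_inner t (A B : Omega -> 'M[R]_n) :
  (forall i j, measurable_wrt (F t) (fun w => A w i j)) ->
  (forall i j, measurable_wrt (F t) (fun w => B w i j)) ->
  measurable_wrt (F t) (fun w => frob_inner (A w) (B w)).
Proof.
move=> mA mB; under eq_fun do rewrite frob_innerE.
apply: measurable_wrt_sum => // i; apply: measurable_wrt_sum => // j.
exact: measurable_wrtM.
Qed.

(** The entries of the gradient are measurable as versions of conditional expectations, and the
    projection is a fixed linear map of these entries. *)
Lemma pgrad_measurable t i j : measurable_wrt (F t) (fun w => pgrad t w i j).
Proof.
have pgradE w : pgrad t w i j =
    \sum_k \sum_l grad t w k l * frob_proj g (delta_mx k l) i j.
  rewrite /pgrad {1}(matrix_sum_delta (grad t w)) linear_sum summxE.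
  apply: eq_bigr => k _; rewrite linear_sum summxE; apply: eq_bigr => l _.
  by rewrite linearZ/= mxE.
under eq_fun do rewrite pgradE.
apply: measurable_wrt_sum => // k; apply: measurable_wrt_sum => // l.
apply: measurable_wrtM => //; last exact: measurable_wrt_cst.
by have [] := ghat_unbiased t k l.
Qed.

Lemma gain_measurable t : measurable_wrt (F t) (gain t).
Proof.
rewrite /gain; under eq_fun do rewrite sqr_frob_norm.
by apply: measurable_wrt_inner; exact: pgrad_measurable.
Qed.

Lemma gain_integrable t : Pintegrable (gain t).
Proof.
have [C C_ge0 C_ae] := pgrad_bounded.
apply: (ae_le_integrable _ (integrable_cst_probability P (C ^+ 2))).
  by apply: measurable_wrt_measurable (gain_measurable t).
apply: filterS C_ae => w /(_ t) Cw.
by rewrite ger0_norm ?sqr_ge0// ler_sqr ?nnegrE ?frob_norm_ge0.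
Qed.

Lemma noiseE t w i j : noise t w i j = ghat t w i j - grad t w i j.
Proof. by rewrite /noise mxE [X in _ + X]mxE. Qed.

Lemma noise_integrable t i j : Pintegrable (fun w => noise t w i j).
Proof.
have [ig _ igr _] := ghat_unbiased t i j.
rewrite (_ : (fun w => _) = (fun w => ghat t w i j - grad t w i j)).
  exact: (integrableB measurableT ig igr).
by apply/funext => w; exact: noiseE.
Qed.

Lemma noise_centered t i j A : F t A -> (\int[P]_(w in A) (noise t w i j)%:E = 0)%E.
Proof.
move=> FA; have mA : measurable A by exact: F_measurable FA.
have [ig _ igr /(_ A FA) gA] := ghat_unbiased t i j.
have igA := integrableS measurableT mA (@subsetT _ A) ig.
have igrA := integrableS measurableT mA (@subsetT _ A) igr.
under eq_integral do rewrite noiseE EFinB.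
by rewrite integralB_EFin// -gA subee//; exact: (integrable_fin_num mA igrA).
Qed.

Lemma cross_term_integrable t i j : Pintegrable (fun w => pgrad t w i j * noise t w i j).
Proof.
have [C C_ge0 C_ae] := pgrad_bounded.
apply: (@integrableM_ae_bounded _ _ _ _ _ _ C).
- exact: measurable_wrt_measurable (pgrad_measurable t i j).
- exact: noise_integrable.
- by apply: filterS C_ae => w /(_ t); apply: le_trans; exact: normr_entry_le.
Qed.

Lemma crossE t w : cross t w = \sum_(p : 'I_n * 'I_n)
  pgrad t w p.1 p.2 * noise t w p.1 p.2.
Proof. by rewrite /cross frob_innerE pair_bigA. Qed.

Lemma cross_integrable t : Pintegrable (cross t).
Proof.
rewrite (_ : EFin \o cross t = fun w => (\sum_(p : 'I_n * 'I_n)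
    (pgrad t w p.1 p.2 * noise t w p.1 p.2)%:E)%E); last first.
  by apply/funext => w /=; rewrite crossE sumEFin.
by apply: integrable_sum => // p _; exact: cross_term_integrable.
Qed.

(** Entry by entry, the indicator of [A] is absorbed into the factor [pgrad]. The product [Y] is
    still known at time [t], and [integral_mul_eq0] applies to it and the centered noise. *)
Lemma cross_centered t A : F t A -> (\int[P]_(w in A) (cross t w)%:E = 0)%E.
Proof.
move=> FA; have mA : measurable A by exact: F_measurable FA.
under eq_integral do rewrite crossE -sumEFin.
have iA (p : 'I_n * 'I_n) : P.-integrable A
    (EFin \o (fun w => pgrad t w p.1 p.2 * noise t w p.1 p.2)).
  exact: (integrableS measurableT mA (@subsetT _ A) (cross_term_integrable _ _ _)).
rewrite integral_sum// big1// => p _.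
pose Y w := \1_A w * pgrad t w p.1 p.2 : R.
have -> : (\int[P]_(w in A) (pgrad t w p.1 p.2 * noise t w p.1 p.2)%:E =
    \int[P]_w (Y w * noise t w p.1 p.2)%:E)%E.
  rewrite integral_mkcond; apply: eq_integral => w _.
  by rewrite /patch /Y indicE; case: ifP; rewrite ?mul1r// !mul0r.
have YE : (fun w => Y w * noise t w p.1 p.2) =
    (fun w => \1_A w * (pgrad t w p.1 p.2 * noise t w p.1 p.2)).
  by apply/funext => w; rewrite /Y mulrA.
apply: (integral_mul_eq0 (F_sigma t) (@F_measurable t)).
- apply: measurable_wrtM => //; first exact: measurable_wrt_indic.
  exact: pgrad_measurable.
- exact: noise_integrable.
- rewrite YE; apply: (@integrableM_ae_bounded _ _ _ _ _ _ 1).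
  + exact: measurable_indic.
  + exact: cross_term_integrable.
  + by apply: aeW => w; rewrite indicE; case: (_ \in _); rewrite ?normr1// normr0.
- by move=> B FB; exact: noise_centered.
Qed.

Lemma noise2_integrable t : Pintegrable (noise2 t).
Proof. by have [V []] := ghat_variance t. Qed.

Lemma noise2_le t : (\int[P]_w (noise2 t w)%:E <= (sigma_g ^+ 2)%:E)%E.
Proof.
have [V [_ _ iV /(_ setT) VT] V_le] := ghat_variance t.
rewrite -VT; last exact: F_setT.
have mV := integrable_measurable_fun iV.
(* [V] may be negative on a null set; its positive part obeys the same almost sure bound and allows
   a comparison of nonnegative functions. *)
apply: (@le_trans _ _ (\int[P]_w ((V^\+)%R w)%:E)%E).
  apply: le_integral => //; first exact: integrable_funrpos.
  by move=> w _; rewrite lee_fin /funrpos le_max lexx.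
rewrite -[leRHS]mule1 -(probability_setT P) -integral_cst//.
apply: ae_ge0_le_integral => //.
- by move=> w _; rewrite lee_fin; exact: funrpos_ge0.
- by apply/measurable_EFinP; exact: measurable_funrpos.
- by move=> w _; rewrite lee_fin sqr_ge0.
- apply: filterS V_le => w Vw _; rewrite lee_fin /funrpos ge_max Vw.
  exact: sqr_ge0.
Qed.

(** * The expected gains and their weighted sum *)

Let Egain t : R := \int[P]_w gain t w.

Lemma EgainE t : (\int[P]_w (gain t w)%:E = (Egain t)%:E)%E.
Proof. by rewrite fineK//; exact: (integrable_fin_num measurableT (gain_integrable t)). Qed.

Lemma Egain_ge0 t : 0 <= Egain t.
Proof. by apply: Rintegral_ge0 => w _; exact: sqr_ge0. Qed.

(** Only the lower bounds [f t] of the increments are integrated. Their sum is bounded on every path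
    by the constant [Jstar - J theta0], by telescoping, and their integrals contain no cross
    term. *)
Lemma sum_Egain_le T :
  \sum_(0 <= t < T) eta t * Egain t <=
    2 * (Jstar - J theta0) + L * sigma_g ^+ 2 * \sum_(0 <= t < T) eta t ^+ 2.
Proof.
pose f t w := eta t / 2 * gain t w + (eta t - L * eta t ^+ 2) * cross t w
    - L / 2 * eta t ^+ 2 * noise2 t w.
have i1 t := integrableZl measurableT (eta t / 2) (gain_integrable t).
have i2 t := integrableZl measurableT (eta t - L * eta t ^+ 2) (cross_integrable t).
have i3 t := integrableZl measurableT (L / 2 * eta t ^+ 2) (noise2_integrable t).
have i12 t := integrableD measurableT (i1 t) (i2 t).
have f_int t : Pintegrable (f t) := integrableB measurableT (i12 t) (i3 t).
have f_ge t : ((eta t / 2 * Egain t - L / 2 * eta t ^+ 2 * sigma_g ^+ 2)%:E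
    <= \int[P]_w (f t w)%:E)%E.
  under eq_integral do rewrite /f EFinB EFinD !EFinM.
  rewrite (integralB measurableT (i12 t) (i3 t)).
  rewrite (integralD measurableT (i1 t) (i2 t)).
  rewrite !integralZl//; try exact: gain_integrable; try exact: cross_integrable;
    try exact: noise2_integrable.
  have -> : (\int[P]_w (EFin \o gain t) w = (Egain t)%:E)%E by exact: EgainE.
  have -> : (\int[P]_w (EFin \o cross t) w = 0)%E by apply: cross_centered.
  rewrite mule0 adde0 EFinB !EFinM; apply: leeB => //.
  apply: lee_wpmul2l; last exact: noise2_le.
  by rewrite -EFinM lee_fin mulr_ge0 ?sqr_ge0// divr_ge0// ltW.
have f_sum w : \sum_(0 <= t < T) f t w <= Jstar - J theta0.
  apply: (@le_trans _ _ (\sum_(0 <= t < T) (J (theta t.+1 w) - J (theta t w)))).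
    by apply: ler_sum => t _; exact: increment_ge.
  rewrite telescope_sumr// theta_init lerD2r; apply: ub_le_sup => //.
  by exists (theta T w) => //; exact: theta_g.
have sum_int : P.-integrable setT (fun w => \sum_(0 <= t < T) (f t w)%:E)%E.
  by apply: integrable_sum => // t _; exact: f_int.
have : (\int[P]_w (\sum_(0 <= t < T) (f t w)%:E) <= (Jstar - J theta0)%:E)%E.
  rewrite -[leRHS]mule1 -(probability_setT P) -integral_cst//.
  apply: le_integral => //; first exact: integrable_cst_probability.
  by move=> w _; rewrite sumEFin lee_fin.
rewrite integral_sum//.
move=> /(le_trans (lee_sum _ (fun t _ => f_ge t))).
rewrite sumEFin lee_fin sumrB.
have -> : \sum_(0 <= t < T) eta t / 2 * Egain t =
    2^-1 * \sum_(0 <= t < T) eta t * Egain t.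
  by rewrite mulr_sumr; apply: eq_bigr => t _; rewrite mulrCA mulrA mulrAC.
have -> : \sum_(0 <= t < T) L / 2 * eta t ^+ 2 * sigma_g ^+ 2 =
    L / 2 * sigma_g ^+ 2 * \sum_(0 <= t < T) eta t ^+ 2.
  by rewrite mulr_sumr; apply: eq_bigr => t _; rewrite mulrAC.
lra.
Qed.

(** * Almost sure convergence for square summable step sizes *)

Section square_summable_steps.
Hypothesis eta2_lty : (\sum_(0 <= t <oo) (eta t ^+ 2)%:E < +oo)%E.

Lemma weighted_gain_lty : (\sum_(0 <= t <oo) (eta t * Egain t)%:E < +oo)%E.
Proof.
pose S := fine (\sum_(0 <= t <oo) (eta t ^+ 2)%:E)%E.
have S_fin : (\sum_(0 <= t <oo) (eta t ^+ 2)%:E)%E \is a fin_num.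
  by rewrite ge0_fin_numE// nneseries_ge0// => t _ _; rewrite lee_fin sqr_ge0.
apply: le_lt_trans (ltry (2 * (Jstar - J theta0) + L * sigma_g ^+ 2 * S)).
apply: partial_sums_le_nneseries => [t|k]; first by rewrite mulr_ge0// Egain_ge0.
apply: le_trans (sum_Egain_le k) _; rewrite lerD2l.
apply: ler_wpM2l; first by rewrite mulr_ge0 ?sqr_ge0 ?frob_norm_ge0// ltW.
rewrite -lee_fin /S fineK// -sumEFin.
by apply: nneseries_lim_ge => t _ _; rewrite lee_fin sqr_ge0.
Qed.

(** The terms are martingale increments. By Cauchy-Schwarz their second moments are at most
    [C ^+ 2 * sigma_g ^+ 2 * eta t ^+ 2], with [C] the bound on the projected gradients, and this is
    summable. *)
Lemma weighted_cross_cvg : {ae P, forall w, cvgn (series (fun t => eta t * cross t w))}.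
Proof.
have [C C_ge0 C_ae] := pgrad_bounded.
have eta_cross_int t : Pintegrable (fun w => eta t * cross t w).
  exact: (integrableZl measurableT (eta t) (cross_integrable t)).
apply: (@square_integrable_martingale_cvg _ _ _ P F F_filtration
  (fun t w => eta t * cross t w) (fun t => C ^+ 2 * sigma_g ^+ 2 * eta t ^+ 2)) => //.
- move=> t.
  have FS : F t `<=` F t.+1 by case: F_filtration => _ _; apply.
  (* [ghat t] is not assumed to be measurable for [F t.+1], but the increment of
     [theta] is. *)
  have -> : (fun w => eta t * cross t w) = (fun w =>
      frob_inner (pgrad t w) (theta t.+1 w - theta t w) - eta t * gain t w).
    apply/funext => w; rewrite theta_step addrAC subrr add0r frob_innerZr.
    by rewrite inner_pgrad_step; ring.
  apply: measurable_wrtB => //.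
    apply: measurable_wrt_inner => i j.
      exact: measurable_wrtS FS (pgrad_measurable t i j).
    under eq_fun do rewrite mxE [X in _ + X]mxE.
    by apply: measurable_wrtB => //; exact: measurable_wrtS FS _.
  apply: measurable_wrtM => //; first exact: measurable_wrt_cst.
  exact: measurable_wrtS FS (gain_measurable t).
- move=> t A FA; have mA : measurable A by exact: F_measurable FA.
  under eq_integral do rewrite EFinM.
  have iA := integrableS measurableT mA (@subsetT _ A) (cross_integrable t).
  by rewrite (integralZl mA iA) cross_centered// mule0.
- move=> t.
  apply: (@le_trans _ _ (\int[P]_w (eta t ^+ 2 * C ^+ 2 * noise2 t w)%:E)%E).
    apply: ae_ge0_le_integral => //.
    + by move=> w _; rewrite lee_fin sqr_ge0.
    + apply/measurable_EFinP/measurable_funX.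
      exact: integrable_measurable_fun (eta_cross_int t).
    + by move=> w _; rewrite lee_fin !mulr_ge0 ?sqr_ge0 ?frob_norm_ge0.
    + apply/measurable_EFinP/measurable_funM => //.
      exact: integrable_measurable_fun (noise2_integrable t).
    + apply: filterS C_ae => w /(_ t) Cw _; rewrite lee_fin exprMn -mulrA.
      apply: ler_wpM2l; first exact: sqr_ge0.
      rewrite -exprMn -[leLHS]ger0_norm ?sqr_ge0// normrX.
      rewrite ler_sqr ?nnegrE; [|exact: normr_ge0|by rewrite mulr_ge0 ?frob_norm_ge0].
      apply: le_trans (frob_inner_le _ _) _.
      by rewrite ler_wpM2r ?frob_norm_ge0.
  under eq_integral do rewrite EFinM.
  rewrite integralZl//; last exact: noise2_integrable.
  have -> : C ^+ 2 * sigma_g ^+ 2 * eta t ^+ 2 = eta t ^+ 2 * C ^+ 2 * sigma_g ^+ 2.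
    by ring.
  rewrite [leRHS]EFinM; apply: lee_wpmul2l; last exact: noise2_le.
  by rewrite lee_fin mulr_ge0 ?sqr_ge0 ?frob_norm_ge0.
- by move=> t; apply: mulr_ge0; first apply: mulr_ge0; exact: sqr_ge0.
- under eq_eseriesr do rewrite EFinM.
  rewrite nneseriesZl; last by move=> t _; rewrite lee_fin sqr_ge0.
  by rewrite lte_mul_pinfty// lee_fin mulr_ge0 ?sqr_ge0 ?frob_norm_ge0.
Qed.

Lemma objective_cvg : {ae P, forall w, cvgn (fun t => J (theta t w))}.
Proof.
have gain_cvg : {ae P, forall w, cvgn (series (fun t => eta t * gain t w))}.
  apply: ae_cvg_series => [t|t w|].
  - apply: measurable_funM => //.
    exact: integrable_measurable_fun (gain_integrable t).
  - by rewrite mulr_ge0 ?gain_ge0.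
  - apply: le_lt_trans weighted_gain_lty.
    rewrite le_eqVlt; apply/orP; left; apply/eqP/eq_eseriesr => t _.
    under eq_integral do rewrite EFinM.
    by rewrite integralZl ?EgainE//; exact: gain_integrable.
have noise_cvg : {ae P, forall w, cvgn (series (fun t => L * eta t ^+ 2 * noise2 t w))}.
  apply: ae_cvg_series => [t|t w|].
  - apply: measurable_funM => //.
    exact: integrable_measurable_fun (noise2_integrable t).
  - by rewrite !mulr_ge0 ?sqr_ge0 ?frob_norm_ge0// ltW.
  - apply: (@le_lt_trans _ _ (\sum_(0 <= t <oo) (L * sigma_g ^+ 2 * eta t ^+ 2)%:E)%E).
      apply: lee_nneseries => [t _ _|t _].
        apply: integral_ge0 => w _.
        by rewrite lee_fin !mulr_ge0 ?sqr_ge0 ?frob_norm_ge0// ltW.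
      under eq_integral do rewrite EFinM.
      rewrite integralZl//; last exact: noise2_integrable.
      rewrite mulrAC [leRHS]EFinM; apply: lee_wpmul2l; last exact: noise2_le.
      by rewrite lee_fin mulr_ge0 ?sqr_ge0 ?frob_norm_ge0// ltW.
    under eq_eseriesr do rewrite EFinM.
    rewrite nneseriesZl; last by move=> t _; rewrite lee_fin sqr_ge0.
    by rewrite lte_mul_pinfty// lee_fin mulr_ge0 ?sqr_ge0 ?frob_norm_ge0// ltW.
apply: filterS3 gain_cvg weighted_cross_cvg noise_cvg => w gw cw nw.
(* The error of the first-order expansion is absolutely summable on this path, being dominated by
   the two convergent nonnegative series. *)
pose err t := J (theta t.+1 w) - J (theta t w) - eta t * (gain t w + cross t w).
have err_cvg : cvgn (series err).
  apply: normed_cvg.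
  apply: (@series_le_cvg _ _ (fun t => eta t * gain t w + L * eta t ^+ 2 * noise2 t w)).
  - by move=> t; exact: normr_ge0.
  - by move=> t; rewrite addr_ge0// !mulr_ge0 ?sqr_ge0 ?frob_norm_ge0// ltW.
  - move=> t; apply: le_trans (increment_dist_le t w) _.
    set N := frob_norm _ ^+ 2.
    have c_ge0 : 0 <= L * eta t ^+ 2 by rewrite mulr_ge0 ?sqr_ge0// ltW.
    (* The bound must hold on each path, so the cross term cannot be averaged out; it is absorbed by
       [2 <G, e> <= |G|^2 + |e|^2]. *)
    have N_le : N <= 2 * (gain t w + noise2 t w).
      apply: le_trans (sqr_norm_step_le t w) _.
      have := double_frob_inner_le (pgrad t w) (noise t w).
      by rewrite -/(gain t w) -/(noise2 t w) -/(cross t w); lra.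
    have := ler_wpM2l c_ge0 N_le.
    have : L * eta t ^+ 2 * gain t w <= eta t * gain t w.
      by rewrite ler_wpM2r// step_le.
    by lra.
  - exact: is_cvg_seriesD gw nw.
have incr_cvg : cvgn (series (fun t => J (theta t.+1 w) - J (theta t w))).
  rewrite (_ : (fun t => _) = (fun t => eta t * gain t w) +
      (fun t => eta t * cross t w) + err).
    by apply: is_cvg_seriesD err_cvg; exact: is_cvg_seriesD.
  by apply/funext => t; rewrite !fctE /err; ring.
rewrite (_ : (fun t => _) = cst (J theta0) +
    series (fun t => J (theta t.+1 w) - J (theta t w))).
  by apply: is_cvgD => //; exact: is_cvg_cst.
apply/funext => t; rewrite !fctE /series/= telescope_sumr// theta_init.
by rewrite addrC subrK.
Qed.

End square_summable_steps.

Lemma expectation_gainE t : ('E_P[gain t] = (Egain t)%:E)%E.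
Proof. by rewrite unlock; exact: EgainE. Qed.

Lemma constant_step_rate T (eta' : R) : (0 < T)%N -> 0 < eta' ->
  (forall t, (t < T)%N -> eta t = eta' / Num.sqrt T%:R) ->
  ('E_P[(fun w => T%:R^-1 * \sum_(0 <= t < T) gain t w)%R] <=
    (2 * (Jstar - J theta0) / (eta' * Num.sqrt T%:R)
     + L * eta' * sigma_g ^+ 2 / Num.sqrt T%:R)%:E)%E.
Proof.
move=> T_gt0 eta'_gt0 etaE; rewrite unlock.
under eq_integral do rewrite mulr_sumr -sumEFin.
have i1 t : Pintegrable (fun w => T%:R^-1 * gain t w).
  exact: (integrableZl measurableT T%:R^-1 (gain_integrable t)).
rewrite integral_sum//.
under eq_bigr => t _ do
  rewrite (integralZl measurableT (gain_integrable t)) EgainE -EFinM.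
rewrite sumEFin lee_fin -mulr_sumr.
have := sum_Egain_le T.
rewrite (eq_big_nat _ _ (F2 := fun t => eta' / Num.sqrt T%:R * Egain t)); last first.
  by move=> t /andP[_ tT]; rewrite etaE.
rewrite -mulr_sumr [X in _ + _ * X](eq_big_nat _ _
  (F2 := fun=> (eta' / Num.sqrt T%:R) ^+ 2)); last first.
  by move=> t /andP[_ tT]; rewrite etaE.
rewrite sumr_const_nat subn0 -[X in _ + _ * X]mulr_natr.
set s := Num.sqrt _; set S := \sum_(0 <= t < T) _ => h.
have s_gt0 : 0 < s by rewrite sqrtr_gt0 ltr0n.
have TE : T%:R = s ^+ 2 by rewrite sqr_sqrtr.
have e_neq0 := lt0r_neq0 eta'_gt0; have s_neq0 := lt0r_neq0 s_gt0.
move: h; rewrite TE => h.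
(* With [T = s ^+ 2], the average is the weighted sum [eta' / s * S] divided by [eta' * s]. The same
   division turns the variance term [L * sigma_g ^+ 2 * eta' ^+ 2] into
   [L * eta' * sigma_g ^+ 2 / s]. *)
have -> : s ^- 2 * S = (eta' * s)^-1 * (eta' / s * S).
  by field; rewrite e_neq0 s_neq0.
apply: le_trans (ler_wpM2l _ h) _.
  by rewrite invr_ge0 mulr_ge0// ltW.
rewrite le_eqVlt; apply/orP; left; apply/eqP.
by field; rewrite e_neq0 s_neq0.
Qed.

End projected_stochastic_gradient.
Theorem corollary7p2 (R : realType) (n : nat)
  (* the matrix Lie algebra *)
  (g : {vspace 'M[R]_n}) (g_lie : is_matrix_lie_algebra g)
  (* the policy objective *)
  (dX : measure_display) (X : measurableType dX)
  (law : 'M[R]_n -> probability X R) (gamma : R) (r : nat -> {mfun X >-> R})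
  (gamma_ge0 : 0 <= gamma) (gamma_lt1 : gamma < 1)
  (return_wd : forall theta, theta \in g -> has_expected_return law gamma r theta)
  (J : 'M[R]_n -> R) (J_def : J = policy_objective law gamma r)
  (* (A1) *)
  (L : R) (L_gt0 : 0 < L)
  (J_diff : forall theta, theta \in g -> differentiable J theta)
  (J_smooth : forall theta theta', theta \in g -> theta' \in g ->
     frob_norm (mx_grad J theta - mx_grad J theta')
       <= L * frob_norm (theta - theta'))
  (* (A2) *)
  (J_bounded : has_ubound [set J theta | theta in [set` g]])
  (* the stochastic gradient iteration *)
  (d : measure_display) (Omega : measurableType d) (P : probability Omega R)
  (F : nat -> set (set Omega)) (F_filtration : is_filtration F)
  (eta : nat -> R) (theta0 : 'M[R]_n) (theta0_g : theta0 \in g)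
  (theta ghat : nat -> Omega -> 'M[R]_n)
  (theta_init : forall w, theta 0%N w = theta0)
  (theta_step : forall t w,
     theta t.+1 w = theta t w + eta t *: frob_proj g (ghat t w))
  (theta_adapted : forall t i j, measurable_wrt (F t) (fun w => theta t w i j))
  (* (A3) *)
  (Btheta : R)
  (theta_bounded : {ae P, forall w, forall t, frob_norm (theta t w) <= Btheta})
  (* (A4) *)
  (ghat_unbiased : forall t i j,
     is_cond_exp P (F t) (fun w => ghat t w i j)
       (fun w => mx_grad J (theta t w) i j))
  (* (A5) *)
  (sigma_g : R)
  (ghat_variance : forall t, exists2 V : Omega -> R,
     is_cond_exp P (F t)
       (fun w => frob_norm (ghat t w - mx_grad J (theta t w)) ^+ 2) V
     & {ae P, forall w, V w <= sigma_g ^+ 2})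
  (* step sizes *)
  (eta_ge0 : forall t, 0 <= eta t) (eta_le : forall t, eta t <= L^-1) :
  let Jstar := sup [set J theta | theta in [set` g]] in
  let pgrad2 t w := frob_norm (frob_proj g (mx_grad J (theta t w))) ^+ 2 in
  (* (A6) is assumed for (i) and (ii) *)
  ((\sum_(0 <= t <oo) (eta t)%:E = +oo)%E ->
   (\sum_(0 <= t <oo) (eta t ^+ 2)%:E < +oo)%E ->
     (* (i) *)
     {ae P, forall w, cvgn (fun t => J (theta t w))} /\
     (* (ii) *)
     ((\sum_(0 <= t <oo) (eta t)%:E * 'E_P[pgrad2 t] < +oo)%E /\
      limn_einf (fun t => 'E_P[pgrad2 t])%E = 0%E)) /\
  (* (iii) *)
  (forall eta' : R, 0 < eta' -> eta' <= L^-1 ->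
     let bound (T : nat) : R :=
       2 * (Jstar - J theta0) / (eta' * Num.sqrt T%:R)
         + L * eta' * sigma_g ^+ 2 / Num.sqrt T%:R in
     (forall T : nat, (0 < T)%N ->
        (forall t, (t < T)%N -> eta t = eta' / Num.sqrt T%:R) ->
        ('E_P[(fun w => T%:R^-1 * \sum_(0 <= t < T) pgrad2 t w)%R]
           <= (bound T)%:E)%E) /\
     bound =O_\oo (fun T : nat => (Num.sqrt T%:R)^-1 : R)).
Proof.
move=> Jstar pgrad2.
split.
  move=> eta_oo eta2_lty; split.
    exact: (objective_cvg F_filtration L_gt0 J_diff J_smooth J_bounded theta0_g
      theta_init theta_step theta_adapted theta_bounded ghat_unbiased ghat_variance
      eta_ge0 eta_le eta2_lty).
  have sum_lty := weighted_gain_lty F_filtration L_gt0 J_diff J_smooth J_bounded theta0_g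
      theta_init theta_step theta_bounded ghat_unbiased ghat_variance
      eta_ge0 eta_le eta2_lty.
  have EE t : ('E_P[pgrad2 t] = (\int[P]_w pgrad2 t w)%:E)%E.
    exact: (expectation_gainE F_filtration L_gt0 J_smooth theta0_g theta_init theta_step
      theta_bounded ghat_unbiased).
  split.
    by under eq_eseriesr => t _ do rewrite EE -EFinM; exact: sum_lty.
  under eq_fun => t do rewrite EE.
  apply: (limn_einf_eq0 eta_ge0 _ eta_oo sum_lty) => t.
  by apply: Rintegral_ge0 => w _; exact: sqr_ge0.
move=> eta' eta'_gt0 eta'_le bound; split.
  move=> T T_gt0 etaE.
  exact: (constant_step_rate F_filtration L_gt0 J_diff J_smooth J_bounded theta0_g
      theta_init theta_step theta_bounded ghat_unbiased ghat_variance
      eta_ge0 eta_le T_gt0 eta'_gt0 etaE).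
pose K := 2 * (Jstar - J theta0) / eta' + L * eta' * sigma_g ^+ 2.
apply/eqO_exP; exists (`|K| + 1); first by rewrite ltr_wpDl.
apply: nearW => T.
(* This also holds at [T = 0], where the inverse of 0 is 0 and both sides vanish. *)
have -> : bound T = K * (Num.sqrt T%:R)^-1.
  by rewrite /bound /K invfM; ring.
by rewrite normrM ler_wpM2r// lerDl.
Qed.
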